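(* Let $1\le p<\infty$ and let $w=\{w_n\}_{n\in\mathbb{N}}$ be a bounded sequence of positive real numbers. Let $F_w:\ell^p(\mathbb{N})\to\ell^p(\mathbb{N})$ be the unilateral weighted forward shift with weights $w$. Then $\sigma_p(F_w)=\emptyset$.
   Context: $\mathbb{N}$ is the set of positive integers, and $\ell^p(\mathbb{N})$ is the complex Banach space of $p$-summable sequences. The unilateral weighted forward shift is $F_w(\{x_1,x_2,\dots\})=\{0,w_1x_1,w_2x_2,\dots\}$. The point spectrum $\sigma_p(T)$ of a bounded operator $T$ is the set of all $\lambda\in\mathbb{C}$ such that $T-\lambda I$ is not injective, i.e. the set of eigenvalues of $T$. *)

(* Defs.v *)
From HB Require Import structures.
From mathcomp Require Import all_boot all_order all_algebra.
From mathcomp Require Import complex.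
From mathcomp Require Import all_classical all_reals all_analysis.

Set Implicit Arguments.
Unset Strict Implicit.
Unset Printing Implicit Defensive.

Import Order.TTheory GRing.Theory Num.Theory.
Import numFieldNormedType.Exports.
Import Normc.

Local Open Scope classical_set_scope.
Local Open Scope complex_scope.
Local Open Scope ring_scope.

Section ellp_enorm.
Context (R : realType).
Implicit Types (p : R) (x y : nat -> R[i]).

(* [ellp_enormE] spells this out as (\sum_k |x_k|^p)^(1/p), possibly +oo. *)
Definition ellp_enorm p x : \bar R :=
  'N[@counting nat R]_p%:E[EFin \o (@normc R \o x)]%E.

Lemma normc_ge0 (z : R[i]) : 0 <= normc z.
Proof. by case: z => a b /=; exact: sqrtr_ge0. Qed.

Lemma normcE (z : R[i]) : `|z| = (normc z)%:C.
Proof. by rewrite normc_def; case: z. Qed.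

Let pow_ge0 p x k : (0 <= (normc (x k) `^ p)%:E)%E.
Proof. by rewrite lee_fin powR_ge0. Qed.

Let sum_ge0 p x N : (0 <= \sum_(N <= k <oo) (normc (x k) `^ p)%:E)%E.
Proof. by apply: nneseries_ge0 => k _ _; exact: pow_ge0. Qed.

Lemma ellp_enorm_ge0 p x : (0 <= ellp_enorm p x)%E.
Proof. exact: Lnorm_ge0. Qed.

Lemma ellp_enormE p x : 0 < p ->
  ellp_enorm p x = ((\sum_(k <oo) (normc (x k) `^ p)%:E) `^ p^-1)%E.
Proof.
move=> p0; rewrite /ellp_enorm Lnorm_counting//; congr (_ `^ _)%E.
by apply: eq_eseriesr => k _ /=; rewrite ger0_norm// normc_ge0.
Qed.

Lemma le_ellp_enorm p x (f : nat -> R) : 0 < p ->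
  (forall k, normc (x k) <= f k) ->
  (ellp_enorm p x <= 'N[@counting nat R]_p%:E[EFin \o f])%E.
Proof.
move=> p0 xf; rewrite ellp_enormE// Lnorm_counting//.
have fp k : (0 <= `|(EFin \o f) k| `^ p)%E by exact: poweR_ge0.
rewrite gt0_ler_poweR//.
- by rewrite invr_ge0 ltW.
- by rewrite in_itv/= leey sum_ge0.
- by rewrite in_itv/= leey nneseries_ge0.
- apply: lee_nneseries => k _; first by move=> _; exact: pow_ge0.
  rewrite /= lee_fin ge0_ler_powR ?nnegrE ?normc_ge0 ?normr_ge0 ?(ltW p0)//.
  exact: le_trans (xf k) (ler_norm _).
Qed.

Lemma ellp_enormD p x y : 1 <= p ->
  (ellp_enorm p (x + y)%R <= ellp_enorm p x + ellp_enorm p y)%E.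
Proof.
move=> p1; apply: le_trans; last first.
  exact: (@minkowski_EFin _ _ _ _ (@normc R \o x) (@normc R \o y)).
apply: le_ellp_enorm => [|k]; first exact: lt_le_trans p1.
exact: le_normcD.
Qed.

Lemma ellp_enormZ p (c : R[i]) x : 0 < p ->
  ellp_enorm p (c *: x) = ((normc c)%:E * ellp_enorm p x)%E.
Proof.
move=> p0; rewrite !ellp_enormE//.
under eq_eseriesr.
  by move=> k _; rewrite normcM powRM ?normc_ge0// EFinM; over.
rewrite nneseriesZl//.
rewrite poweRM ?lee_fin ?powR_ge0//.
by rewrite poweR_EFin -powRrM mulfV ?gt_eqF// powRr1// normc_ge0.
Qed.

Lemma ellp_enorm0 p : 0 < p -> ellp_enorm p 0 = 0%E.
Proof.
by move=> p0; rewrite -[0 in LHS](scale0r 0) ellp_enormZ// normc0 mul0e.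
Qed.

Lemma ellp_enorm_eq0 p x : 0 < p -> ellp_enorm p x = 0%E -> x = 0.
Proof.
move=> p0; rewrite ellp_enormE// => /poweR_eq0_eq0 => /(_ (sum_ge0 _ _ _)) x0.
apply/funext => k; apply: eq0_normc; apply/eqP.
have : ((normc (x k) `^ p)%:E <= 0)%E.
  rewrite -x0 (@nneseriesD1 _ _ k xpredT)// leeDl// nneseries_ge0//.
by rewrite lee_fin le_eqVlt ltNge powR_ge0 orbF powR_eq0 => /andP[].
Qed.

End ellp_enorm.

Definition ellp_pred (R : realType) (p : R) : {pred nat -> R[i]} :=
  fun x => (ellp_enorm p x < +oo)%E.

(* The space of p-summable complex sequences, indexed from 0.  The proof [p1]
   is a parameter of the type because the module and norm structures need it. *)
Record ellp (R : realType) (p : R) (p1 : 1 <= p) : Type := Ellp {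
  ellp_val :> nat -> R[i];
  ellp_valP : ellp_val \in ellp_pred p }.

Section ellp.
Context (R : realType) (p : R) (p1 : 1 <= p).

Let p0 : 0 < p. Proof. exact: lt_le_trans p1. Qed.
Local Notation ellp_pred := (@ellp_pred R p).
Local Notation ellp := (ellp p1).

Lemma ellp_submod_closed : submod_closed ellp_pred.
Proof.
split=> [|c x y]; rewrite !unfold_in/=; first by rewrite ellp_enorm0.
move=> xp yp; apply: le_lt_trans (ellp_enormD _ _ p1) _.
by rewrite lte_add_pinfty// ellp_enormZ// lte_mul_pinfty// lee_fin normc_ge0.
Qed.

HB.instance Definition _ :=
  GRing.isSubmodClosed.Build R[i] (nat -> R[i]) ellp_pred ellp_submod_closed.

HB.instance Definition _ := [isSub for @ellp_val R p p1].
HB.instance Definition _ := gen_eqMixin ellp.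
HB.instance Definition _ := gen_choiceMixin ellp.
HB.instance Definition _ := [SubChoice_isSubLmodule of ellp by <:].

(* The scalar field is R[i], so norms are (real) elements of R[i]. *)
Definition ellp_norm (x : ellp) : R[i] := (fine (ellp_enorm p x))%:C.

Lemma ellp_enorm_fineK (x : ellp) :
  (fine (ellp_enorm p x))%:E = ellp_enorm p x.
Proof. by rewrite fineK// ge0_fin_numE ?ellp_enorm_ge0//; exact: ellp_valP. Qed.

Let ellp_normD (x y : ellp) : ellp_norm (x + y) <= ellp_norm x + ellp_norm y.
Proof.
rewrite /ellp_norm -rmorphD lecR -lee_fin EFinD !ellp_enorm_fineK.
exact: ellp_enormD.
Qed.

Let ellp_normZ (c : R[i]) (x : ellp) : ellp_norm (c *: x) = `|c| * ellp_norm x.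
Proof.
rewrite /ellp_norm normcE -rmorphM; congr (_%:C).
by apply: EFin_inj; rewrite EFinM !ellp_enorm_fineK; exact: ellp_enormZ.
Qed.

Let ellp_norm_eq0 (x : ellp) : ellp_norm x = 0 -> x = 0.
Proof.
move=> /complexI nx0; apply: val_inj; apply: (ellp_enorm_eq0 p0).
by rewrite -[LHS]ellp_enorm_fineK nx0.
Qed.

HB.instance Definition _ :=
  Lmodule_isNormed.Build R[i] ellp ellp_normD ellp_normZ ellp_norm_eq0.

End ellp.

Section forward_shift.
Context (R : realType) (p : R) (p1 : 1 <= p).
Context (w : nat -> R).

(* Index n here is position n+1 of the sequence {x_1, x_2, ...}: x_1, w_1 are
   [x 0], [w 0]. *)
Definition fshift_seq (x : nat -> R[i]) : nat -> R[i] :=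
  fun n => if n is m.+1 then (w m)%:C * x m else 0.

Lemma fshift_enorm M x : (forall n, `|w n| <= M) ->
  (ellp_enorm p (fshift_seq x) <= M%:E * ellp_enorm p x)%E.
Proof.
have p0 : 0 < p by exact: lt_le_trans p1.
move=> wM; have M0 : 0 <= M by exact: le_trans (wM 0%N).
have -> : (M%:E * ellp_enorm p x = ellp_enorm p (M%:C *: x)%R)%E.
  by rewrite ellp_enormZ//= expr0n addr0 sqrtr_sqr ger0_norm.
rewrite [leLHS]ellp_enormE// [leRHS]ellp_enormE// gt0_ler_poweR//.
- by rewrite invr_ge0 ltW.
- by rewrite in_itv/= leey nneseries_ge0// => k _ _; rewrite lee_fin powR_ge0.
- by rewrite in_itv/= leey nneseries_ge0// => k _ _; rewrite lee_fin powR_ge0.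
rewrite nneseries_recl//; last by move=> k _; rewrite lee_fin powR_ge0.
have -> : normc (fshift_seq x 0%N) = 0 by exact: normc0.
rewrite powR0 ?gt_eqF// add0e -nneseries_addn; last first.
  by move=> k; rewrite lee_fin powR_ge0.
apply: lee_nneseries => k _; first by move=> _; rewrite lee_fin powR_ge0.
rewrite addn1 lee_fin ge0_ler_powR ?nnegrE ?normc_ge0 ?(ltW p0)//.
rewrite !normcM ler_wpM2r ?normc_ge0//=.
by rewrite !expr0n !addr0 !sqrtr_sqr (ger0_norm M0).
Qed.

Context (bw : bounded_fun w).

Let w_bnd : exists M, forall n, `|w n| <= M.
Proof.
by have [M _ wM] := ex_strict_bound_gt0 bw; exists M => n; exact/ltW/wM.
Qed.

Lemma fshift_subproof (x : ellp p1) : fshift_seq x \in ellp_pred p.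
Proof.
have [M wM] := w_bnd.
rewrite unfold_in /=; apply: le_lt_trans (fshift_enorm _ wM) _.
rewrite lte_mul_pinfty// ?lee_fin ?(le_trans _ (wM 0%N))//.
exact: ellp_valP.
Qed.

Definition fshift (x : ellp p1) : ellp p1 := Ellp p1 (fshift_subproof x).

Lemma fshift_linear : linear fshift.
Proof.
move=> c x y; apply: val_inj; apply/funext => -[|n] /=.
  by rewrite [RHS](_ : _ = c * 0 + 0)// mulr0 addr0.
rewrite [RHS](_ : _ = c * ((w n)%:C * x n) + (w n)%:C * y n)//.
by rewrite mulrCA -mulrDr.
Qed.

HB.instance Definition _ :=
  GRing.isLinear.Build R[i] (ellp p1) (ellp p1) _ fshift fshift_linear.

Lemma fshift_continuous : continuous fshift.
Proof.
have [M wM] := w_bnd.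
apply: bounded_linear_continuous; apply/linear_boundedP.
exists M%:C; split=> [|r]; first by apply/complex_realP; exists M.
move=> /ltW Mr x.
apply: (@le_trans _ _ (M%:C * `|x|)); last by rewrite ler_wpM2r.
rewrite /Num.norm/= /ellp_norm -rmorphM lecR -lee_fin EFinM !ellp_enorm_fineK.
exact: fshift_enorm.
Qed.

End forward_shift.

Arguments fshift {R p} p1 {w} bw.

Definition point_spectrum (K : numFieldType) (V : normedModType K)
    (T : {linear V -> V}) : set K :=
  [set l | ~ injective (fun x => T x - l *: x)].

(* Main.v *)
Require Import Defs.
From mathcomp Require Import all_boot all_order all_algebra.
From mathcomp Require Import complex.
From mathcomp Require Import all_classical all_reals all_analysis.
Import Order.TTheory GRing.Theory Num.Theory.
Import numFieldNormedType.Exports.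
Local Open Scope classical_set_scope.
Local Open Scope ring_scope.

(** The eigenvalue equation of a forward shift has only the zero solution, for
purely algebraic reasons: read coordinatewise it says that [l * x 0 = 0] and
[l * x n.+1 = w n * x n]. If [l != 0], the first equation kills [x 0] and the
others carry the vanishing along the sequence. If [l = 0], the left-hand sides
vanish, and cancelling the weight [w n] gives [x n = 0] for every [n]. This is
[fshift_seq_eigen0]. Linearity turns the absence of eigenvectors into injectivity
of the shift minus [l] ([point_spectrum_eq0]), which is the form in which the
point spectrum is defined. *)

Lemma fshift_seq_eigen0 (R : realType) (w : nat -> R) (l : R[i])
    (x : nat -> R[i]) :
  (forall n, w n != 0) -> (forall n, fshift_seq w x n = l * x n) ->
  forall n, x n = 0.
Proof.
move=> w0 xl; have [l0 n|l0] := eqVneq l 0.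
  (* For l = 0 it is coordinate n.+1 of the equation that determines x n. *)
  have /eqP := xl n.+1; rewrite l0 mul0r mulf_eq0 => /orP[|/eqP//].
  by rewrite -[0]/(0%:C)%C (inj_eq (@complexI R)) (negPf (w0 n)).
elim=> [|n xn0]; apply: (mulfI l0); rewrite mulr0 -xl //=.
by rewrite xn0 mulr0.
Qed.

(** If [x] and [y] have the same image under [T - l], then [T (x - y)] is
[l *: (x - y)], so the hypothesis applies to [x - y]. *)
Lemma point_spectrum_eq0 (K : numFieldType) (V : normedModType K)
    (T : {linear V -> V}) :
  (forall l z, T z = l *: z -> z = 0) -> point_spectrum T = set0.
Proof.
move=> T0; apply/seteqP; split=> // l; apply => x y /(canRL (subrK _)) Tx.
apply/subr0_eq/(T0 l); rewrite linearB Tx scalerBr.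
by rewrite addrAC (addrAC (T y)) subrr add0r addrC.
Qed.

Lemma fshift_eigen0 (R : realType) (p : R) (p1 : 1 <= p) (w : nat -> R)
    (bw : bounded_fun w) (l : R[i]) (z : ellp p1) :
  (forall n, w n != 0) -> fshift p1 bw z = l *: z -> z = 0.
Proof.
move=> w0 Tz; apply: val_inj; apply/funext.
apply: (@fshift_seq_eigen0 R w l) => // n.
by rewrite -[LHS]/(ellp_val (fshift p1 bw z) n) Tz.
Qed.

Theorem proposition3p1p3 (R : realType) (p : R) (p1 : 1 <= p)
    (w : nat -> R) (w_gt0 : forall n, 0 < w n) (bw : bounded_fun w) :
  point_spectrum (fshift p1 bw) = set0.
Proof.
apply: point_spectrum_eq0 => l z; apply: fshift_eigen0 => n.
by rewrite gt_eqF.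
Qed.
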